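(* Let $(X,\mathcal{A})$ be a measurable space. For every subset $M$ of $M(X)$, $M$ is a fixed maximal ideal of $M(X)$ with $\bigcup_{f\in M}\mathrm{coz}(f)\in\mathcal{A}$ if and only if there exists a prime element $P$ of $\mathcal{A}$ such that $M=M_P$.
   Context: A measurable space $(X,\mathcal{A})$ is a nonempty set $X$ with a $\sigma$-algebra $\mathcal{A}$ of subsets of $X$. $M(X)$ is the commutative ring (pointwise operations) of all functions $f:X\to\mathbb{R}$ with $f^{-1}(V)\in\mathcal{A}$ for every open $V\subseteq\mathbb{R}$. For $f\in M(X)$, $Z(f)=\{x\in X: f(x)=0\}$ and $\mathrm{coz}(f)=X\setminus Z(f)$. An ideal $I$ of $M(X)$ is fixed if $\bigcap_{f\in I}Z(f)\neq\emptyset$. $\mathcal{A}$ is regarded as a lattice under inclusion; a prime element of $\mathcal{A}$ is a $P\in\mathcal{A}$ with $P\subsetneq X$ such that for all $A,B\in\mathcal{A}$, $A\cap B\subseteq P$ implies $A\subseteq P$ or $B\subseteq P$. For $A\in\mathcal{A}$ with $A\subsetneq X$, $M_A=\{f\in M(X):\mathrm{coz}(f)\subseteq A\}$. *)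

(* Defs.v *)
From mathcomp Require Import all_boot all_order all_algebra.
From mathcomp Require Import all_classical all_reals all_analysis.
From mathcomp Require Import measurable_realfun.

Set Implicit Arguments.
Unset Strict Implicit.
Unset Printing Implicit Defensive.

Import Order.TTheory GRing.Theory Num.Theory numFieldNormedType.Exports.

Local Open Scope classical_set_scope.
Local Open Scope ring_scope.

(* A [measurableType] is pointed, hence nonempty. The ring M(X) is
   [{mfun X >-> R}]; its elements are the functions that are measurable for
   the Borel sigma-algebra of R, i.e., those of the next lemma. *)
Lemma measurable_fun_openP (d : measure_display) (X : measurableType d)
    (R : realType) (f : X -> R) :
  measurable_fun setT f <->
  forall V : set R, open V -> measurable (f @^-1` V).
Proof.
split=> [mf V oV|fo].
  by rewrite -[_ @^-1` _]setTI; apply: mf => //; exact: open_measurable.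
apply: (measurability _ (RGenOpens.measurableE R)).
move=> _ [_ [a [b ->] <-]]; rewrite setTI; apply: fo; exact: interval_open.
Qed.

(* [idealr_closed J] says that J is a proper ideal (it includes 1 \notin J). *)
Definition maximal_ideal (A : comNzRingType) (M : set A) : Prop :=
  idealr_closed (mem M) /\
  forall J : set A, idealr_closed (mem J) -> M `<=` J -> J = M.

Section MeasurableFunctionRing.
Context (d : measure_display) (X : measurableType d) (R : realType).

Definition zero_set (f : {mfun X >-> R}) : set X := [set x | f x = 0].

Definition coz (f : {mfun X >-> R}) : set X := ~` zero_set f.

Definition fixed (I : set {mfun X >-> R}) : Prop :=
  \bigcap_(f in I) zero_set f !=set0.

Definition prime_element (P : set X) : Prop :=
  [/\ measurable P, P `<` setT &
      forall A B : set X, measurable A -> measurable B ->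
        A `&` B `<=` P -> A `<=` P \/ B `<=` P].

Definition coz_ideal (A : set X) : set {mfun X >-> R} :=
  [set f | coz f `<=` A].

End MeasurableFunctionRing.

Arguments coz_ideal {d X} R A.

(* Main.v *)
Require Import Defs.
From mathcomp Require Import all_boot all_order all_algebra.
From mathcomp Require Import all_classical all_reals all_analysis.
From mathcomp Require Import measurable_realfun.

Import GRing.Theory.

Local Open Scope classical_set_scope.
Local Open Scope ring_scope.

(** Both sides are compared with the ideals of the functions vanishing at a
    point [x], here written [coz_ideal R (~` [set x])]. Such an ideal is the
    kernel of the evaluation at [x], a morphism onto the field [R], so it is
    maximal ([point_ideal_maximal]).

    If [P] is prime and [x] lies outside [P], then every measurable function
    [f] vanishing at [x] vanishes outside [P]: the sets where [f] is zero, resp.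
    nonzero, are disjoint, so one of them is included in [P], and it cannot be
    the first, which contains [x]. Hence vanishing outside [P] amounts to
    vanishing at [x] ([prime_coz_idealE]), and [coz_ideal R P] is maximal and
    fixed. Its cozero sets cover exactly [P], by the indicator function of [P].

    Conversely, let [M] be a fixed maximal ideal whose cozero sets have a
    measurable union [P]. Any point [x] outside [P] is a common zero of [M], so
    by maximality [M] is the ideal of [x] ([fixed_maximalE]). Thus any function
    vanishing at a single point outside [P] vanishes at all of them. Applied to
    indicator functions, this makes a measurable set that misses one
    point outside [P] a subset of [P], whence primality. *)

Lemma proper_setTP (T : Type) (A : set T) :
  A `<` setT <-> exists x, ~ A x.
Proof.
split=> [[_ nTA]|[x nAx]]; last by split=> // /(_ x I).
apply: contrapT => nA; apply: nTA => x _.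
by apply: contrapT => nAx; apply: nA; exists x.
Qed.

Lemma coz_ideal_sub (d : measure_display) (X : measurableType d)
    (R : realType) (A B : set X) :
  A `<=` B -> coz_ideal R A `<=` coz_ideal R B.
Proof. by move=> AB f fA; apply: subset_trans AB. Qed.

Lemma point_idealE (d : measure_display) (X : measurableType d)
    (R : realType) (x : X) (f : {mfun X >-> R}) :
  coz_ideal R (~` [set x]) f <-> f x = 0.
Proof.
split=> [fx|fx y fy yx]; last by apply: fy; rewrite yx.
by apply: contrapT => /fx; apply.
Qed.

Lemma coz_indic (d : measure_display) (X : measurableType d)
    (R : realType) (A : set X) (mA : measurable A) :
  coz (indic_mfun A mA : {mfun X >-> R}) = A.
Proof.
apply/seteqP; split=> x; rewrite /coz /zero_set /= /mindic indicE.
  by move=> xA; apply: contrapT => nAx; apply: xA; rewrite memNset.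
by move=> Ax; rewrite mem_set//; apply/eqP; exact: oner_neq0.
Qed.

Lemma coz_ideal_idealr_closed (d : measure_display) (X : measurableType d)
    (R : realType) (A : set X) :
  A `<` setT -> idealr_closed (mem (coz_ideal R A)).
Proof.
move=> /proper_setTP[x nAx]; split.
- by apply/mem_set => y; case.
- apply/negP => /set_mem h; apply/nAx/h.
  by rewrite /coz /zero_set /=; apply/eqP; exact: oner_neq0.
- move=> a u v /set_mem uA /set_mem vA; apply/mem_set => y h.
  apply: contrapT => nAy; apply: h; change (a y * u y + v y = 0).
  have -> : u y = 0 by apply: contrapT => /uA.
  have -> : v y = 0 by apply: contrapT => /vA.
  by rewrite mulr0 addr0.
Qed.

(** A function in a larger ideal [J] but not vanishing at [x] is congruent to a
    nonzero constant modulo the functions vanishing at [x], so [J] would contain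
    that constant, which is invertible. *)
Lemma point_ideal_maximal {d : measure_display} {X : measurableType d}
    (R : realType) (x : X) : maximal_ideal (coz_ideal R (~` [set x])).
Proof.
split.
  by apply: coz_ideal_idealr_closed; apply/proper_setTP; exists x; apply.
move=> J [J0 J1 JD] IJ; apply/seteqP; split=> // f Jf.
apply/point_idealE; have [//|fx0] := eqVneq (f x) 0; exfalso.
pose k (c : R) : {mfun X >-> R} := cst c.
have fE : J (f - k (f x)) by apply/IJ/point_idealE; exact: subrr.
have Jk : k (f x) \in mem J.
  have -> : k (f x) = (- 1) * (f - k (f x)) + f.
    by rewrite mulN1r opprB subrK.
  by apply: JD; exact/mem_set.
move/negP: J1; apply.
have -> : 1 = k (f x)^-1 * k (f x) + 0 :> {mfun X >-> R}.
  by rewrite addr0; apply/mfuneqP => y; exact/esym/mulVf.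
exact: JD.
Qed.

(** If [f] vanishes at [x], which is outside [P], the disjoint measurable sets
    [zero_set f] and [coz f] cannot have the former in [P], so primality puts
    the latter there. *)
Lemma prime_coz_idealE {d : measure_display} {X : measurableType d}
    {R : realType} {P : set X} {x : X} :
  prime_element P -> ~ P x -> coz_ideal R P = coz_ideal R (~` [set x]).
Proof.
move=> [mP _ primeP] nPx; apply/seteqP; split.
  by apply: coz_ideal_sub => y Py yx; apply: nPx; rewrite -yx.
move=> f /point_idealE fx0.
have mZ : measurable (zero_set f).
  by rewrite -[zero_set f]setTI;
    exact: (measurable_funP f measurableT [set 0] (measurable_set1 _)).
have [|/(_ x fx0)//|//] := primeP _ _ mZ (measurableC mZ).
by rewrite setICr.
Qed.

Lemma bigcup_coz_coz_ideal (d : measure_display) (X : measurableType d)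
    (R : realType) (A : set X) :
  measurable A -> \bigcup_(f in coz_ideal R A) coz f = A.
Proof.
move=> mA; apply/seteqP; split=> [x [f fA]|x Ax]; first exact: fA.
by exists (indic_mfun A mA); rewrite ?/coz_ideal /= coz_indic.
Qed.

(** A point where every function of [M] vanishes determines [M], since [M] is
    included in the proper ideal of that point. *)
Lemma fixed_maximalE {d : measure_display} {X : measurableType d}
    {R : realType} {M : set {mfun X >-> R}} {x : X} :
  maximal_ideal M -> ~ (\bigcup_(f in M) coz f) x ->
  M = coz_ideal R (~` [set x]).
Proof.
move=> [_ maxM] nPx; apply/esym/maxM; first by case: (point_ideal_maximal R x).
by move=> f Mf; apply/point_idealE; apply: contrapT => fx; apply: nPx; exists f.
Qed.

Theorem proposition13 (d : measure_display) (X : measurableType d)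
    (R : realType) (M : set {mfun X >-> R}) :
  [/\ maximal_ideal M, fixed M & measurable (\bigcup_(f in M) coz f)] <->
  exists P : set X, prime_element P /\ M = coz_ideal R P.
Proof.
split=> [[maxM [x Zx] mP]|[P [primeP ->]]].
  set P := \bigcup_(f in M) coz f in mP *.
  have nPx : ~ P x by move=> [f Mf]; apply; exact: Zx.
  have propP : P `<` setT by apply/proper_setTP; exists x.
  exists P; split; last first.
    apply/esym/(proj2 maxM); first exact: coz_ideal_idealr_closed.
    by move=> f Mf y fy; exists f.
  (* The indicator function of [C] vanishes at [a], hence belongs to [M], which
     is the ideal of [a]. *)
  have missP a C : measurable C -> ~ P a -> ~ C a -> C `<=` P.
    move=> mC nPa nCa y Cy; exists (indic_mfun C mC); last by rewrite coz_indic.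
    rewrite (fixed_maximalE maxM nPa) /coz_ideal /= coz_indic.
    by move=> z Cz za; apply: nCa; rewrite -za.
  split=> // A B mA mB ABP.
  have [Ax|nAx] := pselect (A x); last by left; exact: missP nAx.
  by right; apply: (missP x) => // Bx; apply/nPx/ABP.
have [mP propP _] := primeP.
have /proper_setTP[x nPx] := propP.
split; last by rewrite bigcup_coz_coz_ideal.
- by rewrite (prime_coz_idealE primeP nPx); exact: point_ideal_maximal.
- by exists x; rewrite (prime_coz_idealE primeP nPx) => f /point_idealE.
Qed.
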